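(* Let $H$ be a fixed unicyclic connected planar graph. Then for any sequence $m(n)$ (with $\mathcal{P}(n,m(n))$ nonempty), \[ \limsup_{n\to\infty}\mathbf{P}[P_{n,m}\text{ has a component isomorphic to } H]<1. \]
   Context: $\mathcal{P}(n,m)$ denotes the set of all (simple, labelled) planar graphs on the vertex set $\{1,2,\ldots,n\}$ with exactly $m$ edges, and $P_{n,m}$ denotes a graph chosen uniformly at random from $\mathcal{P}(n,m)$. A connected graph $H$ is unicyclic if $e(H)=|H|$, where $e(H)$ is its number of edges and $|H|$ its number of vertices (equivalently, it contains exactly one cycle). *)

(* Defs.v *)
From HB Require Import structures.
From mathcomp Require Import all_boot all_order all_algebra.
From mathcomp Require Import all_classical all_reals all_analysis.
Import Order.TTheory GRing.Theory Num.Theory.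
Import numFieldNormedType.Exports.

Set Implicit Arguments.
Unset Strict Implicit.
Unset Printing Implicit Defensive.

Local Open Scope ring_scope.

(* A simple graph on the vertex type V is given by its edge set, a set of      *)
(* two-element subsets of V.                                                  *)
Definition simple_graph (V : finType) (E : {set {set V}}) : bool :=
  [forall e in E, #|e| == 2%N].

Definition graph_adj (V : finType) (E : {set {set V}}) : rel V :=
  fun x y => ([set x; y] \in E)%SET.

Definition component (V : finType) (E : {set {set V}}) (x : V) : {set V} :=
  finset (fun y => connect (graph_adj E) x y).

Definition connected_graph (V : finType) (E : {set {set V}}) : bool :=
  (0 < #|V|)%N && [forall x, forall y, connect (graph_adj E) x y].

Definition unicyclic (V : finType) (E : {set {set V}}) : bool :=
  connected_graph E && (#|E| == #|V|).

Definition has_component_iso (U V : finType)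
    (H : {set {set U}}) (E : {set {set V}}) : bool :=
  [exists x : V, exists f : {ffun U -> V},
    [&& injectiveb f,
        (f @: [set: U])%SET == component E x
      & [forall u, forall v, graph_adj H u v == graph_adj E (f u) (f v)]]].

(* A drawing in the plane: vertices are distinct points p v, each edge e is a  *)
(* simple arc gamma e parametrized by [0, 1] which joins its end vertices, and *)
(* the interior of an arc meets neither a vertex nor the interior of another   *)
(* arc.                                                                       *)
Definition is_drawing (R : realType) (V : finType) (E : {set {set V}})
    (p : V -> R * R) (gamma : {set V} -> R -> R * R) : Prop :=
  [/\ injective p,
      forall e, e \in E ->
        [/\ {within `[0, 1], continuous (gamma e)}%classic,
            {in `[0, 1] &, injective (gamma e)}
          & exists x y, [/\ e = [set x; y]%SET,
                            gamma e 0 = p x & gamma e 1 = p y]],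
      forall e t v, e \in E -> t \in `]0, 1[ -> gamma e t <> p v
    & forall e e' s t, e \in E -> e' \in E -> e != e' ->
        s \in `]0, 1[ -> t \in `]0, 1[ -> gamma e s <> gamma e' t].

Definition planar (R : realType) (V : finType) (E : {set {set V}}) : Prop :=
  exists (p : V -> R * R) (gamma : {set V} -> R -> R * R), is_drawing E p gamma.

(* P(n, m), with vertex set {0, ..., n - 1} instead of {1, ..., n}. *)
Definition planar_graphs (R : realType) (n m : nat) : {set {set {set 'I_n}}} :=
  finset (fun E : {set {set 'I_n}} =>
    [&& simple_graph E, #|E| == m & `[< planar R E >]]).

Definition uniform_choice_prob (R : realType) (T : finType) (S : {set T})
    (A : pred T) : R :=
  #|[predI S & A]|%:R / #|S|%:R.

(* Main.v *)
(* Let X(G) be the number of embeddings of H onto components of G, and k the   *)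
(* number of vertices, hence also of edges, of H. Switching: delete the edges *)
(* of one copy of H and string its k vertices along an edge xy with both ends *)
(* outside the copy, replacing xy by a path x, t_1, ..., t_k, y. This keeps   *)
(* the number of edges and planarity, and X drops because the path lies in a  *)
(* component with more than k vertices. There are at least X(G)(m - k) such   *)
(* moves from G. A move is determined by its result and the ordered pair      *)
(* (x, t_1): the t_i have degree two, so the path can be followed from there; *)
(* hence at most 4m moves lead to a given graph. When m < 2k and n > 5k one   *)
(* uses instead the path x, t_1, ..., t_k from an isolated vertex x outside   *)
(* the copy. In both cases double counting bounds the mean of X by a constant *)
(* C and gives |X = j| <= C |X < j|, so that X = 0 has probability bounded    *)
(* away from 0.                                                               *)

Require Import Defs.
From HB Require Import structures.
From mathcomp Require Import all_boot all_order all_algebra.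
From mathcomp Require Import all_classical all_reals all_analysis.
From mathcomp Require Import zify lra.
Import Order.TTheory GRing.Theory Num.Theory.
Import numFieldNormedType.Exports.

Set Implicit Arguments.
Unset Strict Implicit.
Unset Printing Implicit Defensive.
Local Open Scope ring_scope.

(** The switching keeps the number of edges because a unicyclic H has as many edges as vertices:
    deleting the k edges of a copy frees k isolated vertices, and threading these into an edge, or
    hanging them as a path from an isolated vertex, adds k edges. Planarity survives because a
    vertex placed on an arc only cuts it ([planar_subdivide]), and two isolated vertices can be
    joined away from the rest of the drawing ([planar_isolated_edge]); iteration gives
    [subdivide_path] and [attach_path]. [reroute_embs] says that the number X of embeddings drops,
    [reroute_inv] that the move can be undone from its result.

    [card_emb_free] turns these facts into counting. The mean of X is at most C, so at least half of
    the graphs have X <= 2C; the level X = j has at most C times as many graphs as all lower levels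
    together, so 2C levels cost a factor of at most (C + 1)^(2C) over X = 0 ([card_zero_level]).
    Both regimes of m, [card_emb_free_dense] and [card_emb_free_sparse], allow C = 8k. The constant
    thus depends on H alone, and the probability is at most 1 - 1/K for all n > 5k, whatever m
    is. *)

(** * Operations on plane drawings *)

Section Drawings.
Variables (R : realType) (V : finType).
Local Open Scope set_scope.
Implicit Types (E : {set {set V}}) (x y z : V).

Definition isolated E z := [forall e in E, z \notin e].

Lemma isolatedP E z : reflect (forall e, e \in E -> z \notin e) (isolated E z).
Proof. exact: forall_inP. Qed.

Lemma planar_subset E E' : E' \subset E -> planar R E -> planar R E'.
Proof.
move=> /fintype.subsetP sE [p [gamma [pinj arc avoid disj]]]; exists p, gamma.
by split=> // [e /sE/arc|e t v /sE/avoid/[apply]|e e' s t /sE + /sE];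
  [|exact|exact: disj].
Qed.

(* Each arc of the new drawing is the piece [a e, b e] of an arc of the old   *)
(* one, so only pieces of the same arc have to be compared.                   *)
Lemma drawing_pieces E E' (p p' : V -> R * R) (gamma : {set V} -> R -> R * R)
    (par : {set V} -> {set V}) (a b : {set V} -> R) :
  is_drawing E p gamma -> injective p' ->
  (forall e, e \in E' ->
    [/\ par e \in E, 0 <= a e, a e < b e, b e <= 1 &
     exists x y, [/\ e = [set x; y], gamma (par e) (a e) = p' x
                   & gamma (par e) (b e) = p' y]]) ->
  (forall e t v, e \in E' -> a e < t < b e -> gamma (par e) t <> p' v) ->
  (forall e e', e \in E' -> e' \in E' -> e != e' -> par e = par e' ->
     b e <= a e' \/ b e' <= a e) ->
  is_drawing E' p' (fun e t => gamma (par e) (a e + (b e - a e) * t)).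
Proof.
move=> [pinj arc avoid disj] p'inj sub avoid' disj'.
have inside e t : e \in E' -> t \in `]0, 1[ ->
    a e < a e + (b e - a e) * t < b e.
  move=> /sub[_ _ ab _ _]; rewrite in_itv/= => /andP[t0 t1].
  by apply/andP; split; nra.
have inside01 e t : e \in E' -> t \in `[0, 1] ->
    a e + (b e - a e) * t \in `[0, 1].
  move=> /sub[_ a0 ab b1 _]; rewrite !in_itv/= => /andP[t0 t1].
  by apply/andP; split; nra.
split=> //.
- move=> e eE'; have [peE a0 ab b1 [x [y [exy ax bye]]]] := sub _ eE'.
  have [cont inj _] := arc _ peE; split.
  + apply/subspace_continuousP => t t01.
    have /= t01' := inside01 _ _ eE' t01.
    move/subspace_continuousP: cont => /(_ _ t01') ct.
    apply: (cvg_trans _ ct) => A /=; rewrite /nbhs/= /within/=.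
    move=> [r /= r0 rA]; exists r => //= s /= ts s01.
    apply: rA => /=; last exact: (inside01 _ s).
    (* The reparametrization is 1-Lipschitz, as 0 < b e - a e <= 1, so the same radius works. *)
    apply: le_lt_trans ts.
    rewrite opprD addrACA subrr add0r -mulrBr normrM.
    rewrite ger0_norm; last by rewrite subr_ge0 ltW.
    by rewrite ler_piMl//; lra.
  + move=> s t s01 t01 /(inj _ _ (inside01 _ _ eE' s01) (inside01 _ _ eE' t01)).
    move/addrI/mulfI; apply; rewrite subr_eq0 gt_eqF//.
  + exists x, y; split=> //; first by rewrite mulr0 addr0.
    by rewrite mulr1 addrC subrK.
- by move=> e t v eE' /(inside _ _ eE')/(avoid' _ _ v eE').
- move=> e e' s t eE' e'E' ee' /(inside _ _ eE') + /(inside _ _ e'E').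
  set s' := _ + _ * s; set t' := _ + _ * t.
  have [peE a0 ab b1 _] := sub _ eE'; have [pe'E a0' ab' b1' _] := sub _ e'E'.
  move=> /andP[as' sb] /andP[at' tb].
  have s01 : s' \in `]0, 1[ by rewrite in_itv/=; apply/andP; split; lra.
  have t01 : t' \in `]0, 1[ by rewrite in_itv/=; apply/andP; split; lra.
  have [pp|pp] := eqVneq (par e) (par e'); last exact: disj.
  have [_ inj _] := arc _ peE.
  rewrite -pp => /(inj _ _ (subset_itv_oo_cc s01) (subset_itv_oo_cc t01)) st.
  by have [] := disj' _ _ eE' e'E' ee' pp; lra.
Qed.

Lemma set2C x y : [set x; y] = [set y; x].
Proof. exact: finset.setUC. Qed.

(** The arc of xy is cut at parameter 1/2 and z is moved to the cut point; being isolated, z leaves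
    no arc hanging at its old place. *)
Lemma planar_subdivide E x y z :
  planar R E -> isolated E z -> x != y -> z != x -> z != y ->
  [set x; y] \in E ->
  planar R ([set x; z] |: ([set z; y] |: (E :\ [set x; y]))).
Proof.
move=> [p [gamma D]] isoz; have [pinj arc avoid disj] := D.
(* The arc may run from y to x; the hypotheses and the subdivided graph are symmetric in x and y. *)
wlog gx : x y / gamma [set x; y] 0 = p x /\ gamma [set x; y] 1 = p y.
  move=> wl xy zx zy eE.
  have [_ _ [u [v [exy g0 g1]]]] := arc _ eE.
  have : u \in [set x; y] by rewrite exy set21.
  have : v \in [set x; y] by rewrite exy set22.
  rewrite !inE => /orP[]/eqP vE /orP[]/eqP uE; subst u v.
  - by move/setP: exy => /(_ y); rewrite !inE eqxx orbT orbb eq_sym (negbTE xy).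
  - rewrite finset.setUCA (set2C x z) (set2C z y) (set2C x y).
    by apply: wl; rewrite // 1?eq_sym// -?(set2C x y).
  - by apply: wl.
  - by move/setP: exy => /(_ x); rewrite !inE eqxx orbb (negbTE xy).
move: gx => [gx gy] xy zx zy e0E.
have [_ inj0 _] := arc _ e0E.
set e0 := [set x; y] in gx gy e0E inj0 *.
set E' := _ |: _.
have niz (e : {set V}) : z \in e -> e \notin E.
  by move=> ze; apply/negP => /(isolatedP _ _ isoz); rewrite ze.
pose p' v := if v == z then gamma e0 (2%:R^-1) else p v.
have h01 : (2%:R^-1 : R) \in `]0, 1[ by rewrite in_itv/=; apply/andP; split; lra.
pose e1 := [set x; z]; pose e2 := [set z; y].
have e12 : e1 != e2.
  by apply/eqP => /setP/(_ x); rewrite !inE eqxx (eq_sym x z) (negbTE zx) (negbTE xy).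
(* Both halves come from the arc of [e0]; every other edge keeps its whole arc. *)
pose par e := if e == e1 then e0 else if e == e2 then e0 else e.
pose a e : R := if e == e2 then 2%:R^-1 else 0.
pose b e : R := if e == e1 then 2%:R^-1 else 1.
have e1E : e1 \notin E by apply: niz; rewrite set22.
have e2E : e2 \notin E by apply: niz; rewrite set21.
have inE' e : e \in E' -> [\/ e = e1, e = e2 | [/\ e \in E, e != e0, e != e1 & e != e2]].
  rewrite /E' !inE => /or3P[/eqP->|/eqP->|/andP[ee0 eE]]; [exact: Or31|exact: Or32|].
  by apply: Or33; split=> //; apply: contraTneq eE => ->.
exists p', (fun e t => gamma (par e) (a e + (b e - a e) * t)).
have p'x : p' x = p x by rewrite /p' eq_sym (negbTE zx).
have p'y : p' y = p y by rewrite /p' eq_sym (negbTE zy).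
have p'z : p' z = gamma e0 (2%:R^-1) by rewrite /p' eqxx.
apply: (drawing_pieces D).
- move=> u v; rewrite /p'; case: eqVneq => [->|uz]; case: eqVneq => [->|vz] //.
  + by move=> /(avoid _ _ _ e0E h01).
  + by move=> /esym/(avoid _ _ _ e0E h01).
  + exact: pinj.
- move=> e /inE'[->|->|[eE _ /negbTE ee1 /negbTE ee2]].
  + rewrite /par /a /b eqxx (negbTE e12);
      split; [by []|clear; lra|clear; lra|clear; lra|].
    by exists x, z; rewrite p'x p'z.
  + rewrite /par /a /b eqxx eq_sym (negbTE e12);
      split; [by []|clear; lra|clear; lra|clear; lra|].
    by exists z, y; rewrite p'y p'z.
  + rewrite /par /a /b ee1 ee2; split=> //.
    have [_ _ [u [v [euv g0 g1]]]] := arc _ eE.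
    have := isolatedP _ _ isoz _ eE; rewrite {1}euv !inE negb_or ![z == _]eq_sym.
    move=> /andP[/negbTE uz /negbTE vz].
    by exists u, v; rewrite /p' uz vz.
- move=> e t v eE' atb.
  have t01 : t \in `]0, 1[.
    move: atb; rewrite /a /b in_itv/= => /andP[].
    by case: ifP => _; case: ifP => _ H1 H2; clear -H1 H2; apply/andP; split; lra.
  rewrite /p'; case: eqVneq => _; last first.
    apply: avoid => //; rewrite /par.
    by have /inE'[->|->|[eE _ _ _]] := eE'; rewrite ?eqxx //; do 2 case: ifP => //.
  move: atb; have /inE'[->|->|[eE ee0 /negbTE ee1 /negbTE ee2]] := eE'.
  + rewrite /par /a /b eqxx (negbTE e12) => /andP[_ tb] /inj0.
    by move=> /(_ (subset_itv_oo_cc t01) (subset_itv_oo_cc h01)) th; clear -tb th; lra.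
  + rewrite /par /a /b eqxx eq_sym (negbTE e12) => /andP[tb _] /inj0.
    by move=> /(_ (subset_itv_oo_cc t01) (subset_itv_oo_cc h01)) th; clear -tb th; lra.
  + by rewrite /par ee1 ee2 => _; apply: disj.
- have e21 : (e2 == e1) = false by rewrite eq_sym (negbTE e12).
  move=> e e' /inE'[->|->|[_ ee0 /negbTE ee1 /negbTE ee2]]
    /inE'[->|->|[_ e'e0 /negbTE e'e1 /negbTE e'e2]];
    rewrite /par /a /b ?eqxx ?ee1 ?ee2 ?e'e1 ?e'e2 ?(negbTE e12) ?e21 //.
  + by left.
  + by move=> _ e0e'; rewrite e0e' eqxx in e'e0.
  + by right.
  + by move=> _ e0e'; rewrite e0e' eqxx in e'e0.
  + by move=> _ e0e; rewrite e0e eqxx in ee0.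
  + by move=> _ e0e; rewrite e0e eqxx in ee0.
  + by move=> /eqP ee' /ee'.
Qed.

Lemma arc_bounded (g : R -> R * R) :
  {within `[0, 1], continuous g}%classic ->
  exists M : R, forall t, t \in `[0, 1] -> (g t).1 <= M.
Proof.
move=> cg.
have [|c _ cmax] := @EVT_max R (fst \o g) 0 1 ler01; last by exists (g c).1.
by apply: within_continuous_comp cg => u _; exact: cvg_fst.
Qed.

Lemma finite_bound (T : finType) (P : T -> R -> Prop) :
  (forall t M N, P t M -> M <= N -> P t N) ->
  (forall t, exists M, P t M) -> exists M, forall t, P t M.
Proof.
(* The sum of the absolute values dominates each pointwise bound. *)
move=> mono /choice[f fP]; exists (\sum_t `|f t|) => t.
apply: mono (fP t) _; apply: le_trans (ler_norm _) _.
by rewrite (bigD1 t)//= lerDl sumr_ge0.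
Qed.

(* The new edge is drawn to the right of a vertical line bounding the given   *)
(* drawing.                                                                   *)
Lemma planar_isolated_edge E x y :
  planar R E -> isolated E x -> isolated E y -> x != y ->
  planar R ([set x; y] |: E).
Proof.
move=> [p [gamma [pinj arc avoid disj]]] /isolatedP isox /isolatedP isoy xy.
have [M1 M1P] : exists M, forall v, (p v).1 <= M.
  apply: finite_bound => [v M N|v]; first exact: le_trans.
  by exists (p v).1.
have [M2 M2P] : exists M, forall e, e \in E -> forall t, t \in `[0, 1] ->
    (gamma e t).1 <= M.
  apply: finite_bound => [e M N eM MN eE t t01|e].
    exact: le_trans (eM eE t t01) MN.
  have [eE|_] := boolP (e \in E); last by exists 0.
  by have [cont _ _] := arc _ eE; have [M] := arc_bounded cont; exists M.
pose M := Num.max M1 M2; pose e0 := [set x; y].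
pose p' v := if v == x then (M + 1, 0) else if v == y then (M + 2, 0) else p v.
pose g' e t := if e == e0 then (M + 1 + t, 0) else gamma e t.
have pM v : (p v).1 <= M by rewrite le_max M1P.
have gM e t : e \in E -> t \in `]0, 1[ -> (gamma e t).1 <= M.
  by move=> eE /subset_itv_oo_cc t01; rewrite le_max M2P ?orbT.
have e0E e : e \in E -> (e == e0) = false.
  by move=> eE; apply: contraTF (isox _ eE) => /eqP->; rewrite negbK set21.
have p'x : p' x = (M + 1, 0) by rewrite /p' eqxx.
have p'y : p' y = (M + 2, 0) by rewrite /p' eq_sym (negbTE xy) eqxx.
exists p', g'; split.
- move=> u v; rewrite /p'.
  case: (eqVneq u x) => [->|ux]; [|case: (eqVneq u y) => [->|uy]];
    (case: (eqVneq v x) => [->|vx]; [|case: (eqVneq v y) => [->|vy]]) => //.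
  + by case=> h; exfalso; move: h; clear; lra.
  + by move=> pE; exfalso; have := pM v; rewrite -pE/=; clear; lra.
  + by case=> h; exfalso; move: h; clear; lra.
  + by move=> pE; exfalso; have := pM v; rewrite -pE/=; clear; lra.
  + by move=> pE; exfalso; have := pM u; rewrite pE/=; clear; lra.
  + by move=> pE; exfalso; have := pM u; rewrite pE/=; clear; lra.
  + exact: pinj.
- move=> e /finset.setU1P[->|eE]; rewrite /g' ?eqxx ?e0E//.
  + split.
    * apply: continuous_subspaceT => t.
      have c1 : (M + 1 + s @[s --> t] --> M + 1 + t)%classic.
        by apply: cvgD; [exact: cvg_cst|exact: cvg_id].
      have c2 : ((0 : R) @[s --> t] --> (0 : R))%classic by exact: cvg_cst.
      exact: (cvg_pair c1 c2).
    * by move=> s t _ _ [] /addrI.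
    * exists x, y; rewrite p'x p'y addr0; split=> //.
      by congr (_, _); clear; lra.
  + have [cont inj [u [v [euv g0 g1]]]] := arc _ eE; split=> //.
    exists u, v; rewrite /p'.
    have := isox _ eE; have := isoy _ eE.
    rewrite {1 2}euv !inE !negb_or.
    rewrite ![x == _]eq_sym ![y == _]eq_sym.
    by move=> /andP[/negbTE-> /negbTE->] /andP[/negbTE-> /negbTE->].
- move=> e t v /finset.setU1P[->|eE] t01; rewrite /g' ?eqxx ?e0E// /p'.
  + move: t01; rewrite in_itv/= => /andP[t0 t1].
    case: ifP => _; first by case; move: t0 t1; clear; lra.
    case: ifP => _; first by case; move: t0 t1; clear; lra.
    by move=> pE; have := pM v; rewrite -pE/=; move: t0; clear; lra.
  + have gMt := gM _ _ eE t01.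
    case: ifP => _; first by move=> gE; move: gMt; rewrite gE/=; clear; lra.
    case: ifP => _; first by move=> gE; move: gMt; rewrite gE/=; clear; lra.
    exact: avoid.
- move=> e e' s t /finset.setU1P[->|eE] /finset.setU1P[->|e'E];
    rewrite /g' ?eqxx ?e0E// => ee' s01 t01.
  + move=> gE; have := gM _ _ e'E t01; rewrite -gE/=.
    by move: s01; rewrite in_itv/= => /andP[]; clear; lra.
  + move=> gE; have := gM _ _ eE s01; rewrite gE/=.
    by move: t01; rewrite in_itv/= => /andP[]; clear; lra.
  + exact: disj.
Qed.

End Drawings.

(** * Double counting of moves *)

Section Counting.
Local Open Scope set_scope.
Local Open Scope nat_scope.

(** The bound on the mean puts at least half of [S] on the levels X <= 2C; the level bound lets the
    part below j grow by a factor of at most C + 1 at each step, starting from X = 0. *)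
Lemma card_zero_level (T : finType) (S : {set T}) (X : T -> nat) (C : nat) :
  (forall j, \sum_(G in S | X G == j) X G <= C * #|[set G in S | X G < j]|) ->
  \sum_(G in S) X G <= C * #|S| ->
  #|S| <= 2 * C.+1 ^ (2 * C) * #|[set G in S | X G == 0]|.
Proof.
move=> level total; pose L j := #|[set G in S | X G < j]|.
(* [L 0] is zero, so the recursion really starts at [L 1]; the maximum lets one inequality cover j =
   0 as well. *)
have LS j : L j.+1 <= C.+1 * maxn (L j) (L 1).
  case: j => [|j]; first by rewrite (leq_trans (leq_maxr (L 0) (L 1)))// leq_pmull.
  apply: (@leq_trans (C.+1 * L j.+1)); last by rewrite leq_mul2l leq_maxl orbT.
  have -> : L j.+2 = L j.+1 + \sum_(G in S | X G == j.+1) 1.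
    rewrite /L -!sum1_card.
    rewrite (bigID (fun G => X G < j.+1))/=; congr (_ + _); apply: eq_bigl => G.
      by rewrite !inE; case: (G \in S) => //=; lia.
    by rewrite !inE; case: (G \in S) => //=; lia.
  rewrite mulSn leq_add2l; apply: leq_trans (level j.+1).
  by apply: leq_sum => G /andP[_ /eqP->].
have Lexp j : L j.+1 <= C.+1 ^ j * L 1.
  elim: j => [|j IH]; first by rewrite expn0 mul1n.
  apply: leq_trans (LS _) _; rewrite expnS -mulnA leq_mul2l/=.
  by rewrite geq_max IH leq_pmull// expn_gt0.
have L1 : L 1 = #|[set G in S | X G == 0]|.
  by congr #|pred_of_set _|; apply/setP => G; rewrite !inE ltnS leqn0.
(* Markov's inequality: C / (2C + 1) < 1/2, so the levels above 2C hold at most half of [S]. *)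
have markov : (2 * C).+1 * #|[set G in S | (2 * C).+1 <= X G]| <= C * #|S|.
  apply: leq_trans total; rewrite mulnC -sum_nat_const.
  rewrite [leqRHS](bigID (fun G => (2 * C).+1 <= X G))/=.
  apply: leq_trans (leq_addr _ _).
  rewrite (eq_bigl (fun G => (G \in S) && ((2 * C).+1 <= X G))); last first.
    by move=> G; rewrite inE.
  by apply: leq_sum => G /andP[].
have split_S : #|S| = L (2 * C).+1 + #|[set G in S | (2 * C).+1 <= X G]|.
  rewrite /L -!sum1_card (bigID (fun G => X G < (2 * C).+1))/=.
  congr (_ + _); apply: eq_bigl => G; rewrite !inE//.
  by rewrite -leqNgt.
rewrite -L1; have := Lexp (2 * C); nia.
Qed.

(** Moves (G, f, i) are counted twice: each embedding admits at least D of them, and [dec] recovers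
    a move from its result and a code, so at most C * D moves end in a given graph. *)
Lemma card_emb_free (T F I J : finType) (S : {set T}) (emb : T -> {set F})
    (A : T -> F -> {set I}) (act : T -> F -> I -> T)
    (codes : T -> {set J}) (dec : T -> J -> T * F * I) (C D : nat) :
  0 < D ->
  (forall G f, G \in S -> f \in emb G -> D <= #|A G f|) ->
  (forall G f i, G \in S -> f \in emb G -> i \in A G f ->
     [/\ act G f i \in S, #|emb (act G f i)| < #|emb G| &
         exists2 j, j \in codes (act G f i) & dec (act G f i) j = (G, f, i)]) ->
  (forall G, G \in S -> #|codes G| <= C * D) ->
  #|S| <= 2 * C.+1 ^ (2 * C) * #|[set G in S | #|emb G| == 0]|.
Proof.
move=> D0 Amany actP codes_few.
(* Used with X = j and X < j for the level bound, and with two trivial conditions for the mean. *)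
have step (P P' : pred T) :
    (forall G f i, G \in S -> f \in emb G -> i \in A G f -> P G -> P' (act G f i)) ->
    \sum_(G in S | P G) #|emb G| <= C * #|[set G in S | P' G]|.
  move=> PP'; rewrite -(leq_pmul2l D0) mulnCA (mulnC D) mulnA.
  pose moves := [set q : T * F * I | [&& q.1.1 \in S, P q.1.1, q.1.2 \in emb q.1.1
                                       & q.2 \in A q.1.1 q.1.2]].
  pose marked := [set r : T * J | [&& r.1 \in S, P' r.1 & r.2 \in codes r.1]].
  apply: (@leq_trans #|moves|).
    rewrite -sum1_card (eq_bigl (fun q : T * F * I =>
      ((q.1.1 \in S) && P q.1.1 && (q.1.2 \in emb q.1.1)) &&
      (q.2 \in A q.1.1 q.1.2))); last by move=> q; rewrite inE !andbA.
    rewrite -(pair_big_dep (fun p : T * F => (p.1 \in S) && P p.1 && (p.2 \in emb p.1))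
       (fun p i => i \in A p.1 p.2) (fun _ _ => 1))/=.
    rewrite -(pair_big_dep (fun G => (G \in S) && P G) (fun G f => f \in emb G)
       (fun G f => \sum_(i in A G f) 1))/=.
    rewrite big_distrl/=; apply: leq_sum => G /andP[GS _].
    rewrite -sum_nat_const; apply: leq_sum => f fG.
    by rewrite sum1_card Amany.
  apply: (@leq_trans #|marked|).
    have sub : moves \subset [set dec r.1 r.2 | r in marked].
      apply/fintype.subsetP => -[[G f] i]; rewrite !inE/= => /and4P[GS PG fG iA].
      have [G'S _ [j jc jd]] := actP _ _ _ GS fG iA.
      apply/imsetP; exists (act G f i, j); last by rewrite jd.
      by rewrite inE/= G'S jc (PP' _ _ _ GS).
    exact: leq_trans (subset_leq_card sub) (leq_imset_card _ _).
  rewrite -sum1_card (eq_bigl (fun r : T * J =>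
    ((r.1 \in S) && P' r.1) && (r.2 \in codes r.1))); last first.
    by move=> r; rewrite inE andbA.
  rewrite -(pair_big_dep (fun G => (G \in S) && P' G) (fun G j => j \in codes G)
       (fun _ _ => 1))/=.
  rewrite -[leqRHS]mulnC -sum_nat_const.
  rewrite [leqRHS](eq_bigl (fun G => (G \in S) && P' G)); last first.
    by move=> G; rewrite inE.
  by apply: leq_sum => G /andP[GS _]; rewrite sum1_card codes_few.
apply: card_zero_level => [j|].
  apply: step => G f i GS fG iA /eqP <-.
  by have [] := actP _ _ _ GS fG iA.
rewrite (eq_bigl (fun G => (G \in S) && true)); last by move=> G; rewrite andbT.
apply: leq_trans (step predT predT _) _ => //.
rewrite leq_mul2l; apply/orP; right; apply/subset_leq_card/fintype.subsetP => G.
by rewrite inE => /andP[].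
Qed.

End Counting.

(** * Inserting paths and following them *)

Section Paths.
Variable V : finType.
Local Open Scope set_scope.
Local Open Scope nat_scope.
Implicit Types (E : {set {set V}}) (x y z : V) (s : seq V).

Fixpoint walk_edges x s : {set {set V}} :=
  if s is y :: s' then [set x; y] |: walk_edges y s' else finset.set0.

Lemma walk_edges_vertex x s (e : {set V}) z :
  e \in walk_edges x s -> z \in e -> z \in x :: s.
Proof.
elim: s x => [|y s IH] x /=; first by rewrite inE.
move=> /finset.setU1P[->|/IH/[apply]]; last by rewrite !inE => ->; rewrite orbT.
by rewrite !inE => /orP[] ->; rewrite ?orbT.
Qed.

Lemma path_walk_edges E x s : walk_edges x s \subset E -> path (graph_adj E) x s.
Proof.
elim: s x => //= y s IH x /fintype.subsetP sE.
apply/andP; split; first by apply: sE; rewrite setU11.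
by apply: IH; apply/fintype.subsetP => e es; apply: sE; rewrite inE es orbT.
Qed.

Lemma eq_set2l x y z : [set x; y] = [set x; z] -> y = z.
Proof.
move=> /setP xyz; have := xyz z; have := xyz y; rewrite !inE !eqxx !orbT.
by case: (eqVneq y z); case: (eqVneq y x) => [->|]; case: (eqVneq z x) => [->|].
Qed.

Lemma graph_adjC E : symmetric (graph_adj E).
Proof. by move=> x y; rewrite /graph_adj finset.setUC. Qed.

Lemma simple_edge E (e : {set V}) : simple_graph E -> e \in E ->
  exists x y, x != y /\ e = [set x; y].
Proof.
by move=> /forall_inP sE /sE/cards2P[x [y [xy ->]]]; exists x, y.
Qed.

Lemma simple_adj E x y : simple_graph E -> graph_adj E x y -> x != y.
Proof. by move=> /forall_inP sE /sE; rewrite cards2 eqSS eqb1. Qed.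

Lemma subset_simple E E' : E' \subset E -> simple_graph E -> simple_graph E'.
Proof.
by move=> /fintype.subsetP sE /forall_inP sg; apply/forall_inP => e /sE/sg.
Qed.

Lemma subset_isolated E E' z : E' \subset E -> isolated E z -> isolated E' z.
Proof.
by move=> /fintype.subsetP sE /isolatedP iso; apply/isolatedP => e /sE/iso.
Qed.

(** The first new vertex z subdivides xy, the rest of the path subdivides zy; each subdivision
    trades one edge for two. *)
Lemma subdivide_path (R : realType) E x y s :
  simple_graph E -> planar R E -> [set x; y] \in E ->
  uniq (x :: rcons s y) -> {in s, forall z, isolated E z} ->
  let E' := (E :\ [set x; y]) :|: walk_edges x (rcons s y) in
  [/\ simple_graph E', #|E'| = #|E| + size s & planar R E'].
Proof.
elim: s E x => [|z s IH] E x simpleE planarE xyE uxs iso /=.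
  have -> : E :\ [set x; y] :|: ([set x; y] |: finset.set0) = E.
    by apply/setP => e; rewrite !inE orbF; case: eqVneq => [->|]; rewrite ?orbF.
  by rewrite addn0.
have isoz : isolated E z by apply: iso; rewrite mem_head.
move: uxs; rewrite /= !inE mem_rcons inE !negb_or => /andP[/and3P[xz xy xs] uzs].
have /andP[] := uzs; rewrite mem_rcons inE negb_or => /andP[zy zs] _.
pose E1 := [set x; z] |: ([set z; y] |: (E :\ [set x; y])).
have niz (e : {set V}) : z \in e -> (e \in E) = false.
  by move=> ze; apply/negP => /(isolatedP _ _ isoz); rewrite ze.
have e12 : [set x; z] != [set z; y].
  by apply/eqP => /setP/(_ x); rewrite !inE eqxx (negbTE xz) (negbTE xy).
have simpleE1 : simple_graph E1.
  apply/forall_inP => e; rewrite !inE => /or3P[/eqP->|/eqP->|/andP[_]].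
  - by rewrite cards2 xz.
  - by rewrite cards2 zy.
  - exact: (forall_inP simpleE).
have planarE1 : planar R E1.
  by apply: planar_subdivide => //; rewrite eq_sym.
have cardE1 : #|E1| = #|E|.+1.
  rewrite !cardsU1 !inE (negbTE e12) !niz ?set21 ?set22// !andbF/=.
  by rewrite (cardsD1 [set x; y] E) xyE.
have zyE1 : [set z; y] \in E1 by rewrite !inE eqxx orbT.
have isoE1 : {in s, forall w, isolated E1 w}.
  move=> w ws; apply/isolatedP => e; rewrite !inE.
  have wx : w != x by apply: contraNneq xs => <-.
  have wz : w != z by apply: contraNneq zs => <-.
  have wy : w != y.
    move: uzs; rewrite /= rcons_uniq => /and3P[_ ys _].
    by apply: contraNneq ys => <-.
  move=> /or3P[/eqP->|/eqP->|/andP[_ eE]]; rewrite ?inE ?negb_or ?wx ?wz ?wy//.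
  by apply: (isolatedP _ _ (iso w _)) eE; rewrite inE ws orbT.
have [] := IH E1 z simpleE1 planarE1 zyE1 uzs isoE1.
have -> : E1 :\ [set z; y] :|: walk_edges z (rcons s y) =
   E :\ [set x; y] :|: ([set x; z] |: walk_edges z (rcons s y)).
  rewrite finset.setUA; congr (_ :|: _); apply/setP => e; rewrite !inE.
  case: (eqVneq e [set z; y]) => [->|_] /=.
    by rewrite niz ?set21// andbF/= eq_sym (negbTE e12).
  by rewrite orbC.
by rewrite cardE1 addSnnS.
Qed.

(** An auxiliary edge from x to the last vertex y is drawn first; subdividing it by the remaining
    vertices replaces it by the path. *)
Lemma attach_path (R : realType) E x s :
  simple_graph E -> planar R E -> isolated E x ->
  uniq (x :: s) -> {in s, forall z, isolated E z} -> 0 < size s ->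
  let E' := E :|: walk_edges x s in
  [/\ simple_graph E', #|E'| = #|E| + size s & planar R E'].
Proof.
move=> simpleE planarE isox; case/lastP: s => // s y uxs iso _ /=.
have isoy : isolated E y by apply: iso; rewrite mem_rcons mem_head.
have xy : x != y.
  by move: uxs; rewrite /= mem_rcons inE negb_or => /andP[/andP[]].
have ys : y \notin s by move: uxs; rewrite /= rcons_uniq => /and3P[].
have xs : x \notin s.
  by move: uxs; rewrite /= mem_rcons inE negb_or => /andP[/andP[]].
have xyE : [set x; y] \notin E.
  by apply/negP => /(isolatedP _ _ isox); rewrite set21.
have [] := @subdivide_path R ([set x; y] |: E) x y s _ _ (setU11 _ _) uxs.
- apply/forall_inP => e /finset.setU1P[->|]; first by rewrite cards2 xy.
  exact: (forall_inP simpleE).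
- exact: planar_isolated_edge.
- move=> z zs; apply/isolatedP => e /finset.setU1P[->|eE].
    rewrite !inE negb_or; apply/andP; split.
      by apply: contraNneq xs => <-.
    by apply: contraNneq ys => <-.
  by apply: (isolatedP _ _ (iso z _)) eE; rewrite mem_rcons inE zs orbT.
- by rewrite finset.setU1K// cardsU1 xyE size_rcons addnS add1n addSn.
Qed.

(** The walk leaves y by a neighbour other than x, where it came from; at a vertex of degree two the
    choice is forced. The default y only fills in when there is no such neighbour. *)
Fixpoint follow E x y n : seq V :=
  if n is n'.+1 then
    let z := odflt y [pick z | graph_adj E y z && (z != x)] in
    z :: follow E y z n'
  else [::].

(** Inner vertices of the path carry path edges only, so [pick] has exactly one candidate at each of
    them. *)
Lemma follow_path E x y s : uniq [:: x, y & s] ->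
  (forall z w, z \in belast y s ->
     graph_adj E z w = ([set z; w] \in walk_edges x (y :: s))) ->
  follow E x y (size s) = s.
Proof.
elim: s x y => //= z s IH x y /and4P[xyzs yzs zs us] adjE.
have adjy w : graph_adj E y w = ([set y; w] \in walk_edges x [:: y, z & s]).
  by rewrite adjE ?mem_head.
move: xyzs; rewrite !inE !negb_or => /and3P[xy xz xs].
have zE : odflt y [pick w | graph_adj E y w && (w != x)] = z.
  case: pickP => [w|/(_ z)] /=; last first.
    by rewrite adjy/= eq_sym xz !inE eqxx !orbT.
  rewrite adjy /= => /andP[/finset.setU1P[|/finset.setU1P[|]]].
  - by rewrite (finset.setUC [set x]) => /eq_set2l->; rewrite eqxx.
  - by move=> /eq_set2l.
  - by move=> /walk_edges_vertex/(_ (set21 _ _)); rewrite (negbTE yzs).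
rewrite zE; congr (_ :: _); apply: IH => [|w v ws]; first by rewrite /= yzs zs.
rewrite adjE; last by rewrite inE ws orbT.
rewrite /= in_setU1; apply/orb_idl => /eqP/setP/(_ w).
rewrite !inE eqxx/= => /esym/orP[]/eqP wE; subst w.
  by move: ws => /mem_belast; rewrite inE (negbTE xz) (negbTE xs).
by move: ws => /mem_belast; rewrite (negbTE yzs).
Qed.

Lemma card_darts E : simple_graph E ->
  #|[set d : V * V | graph_adj E d.1 d.2]| <= 4 * #|E|.
Proof.
move=> simpleE; rewrite -sum1_card.
rewrite (partition_big (fun d : V * V => [set d.1; d.2]) (mem E))/=; last first.
  by move=> d; rewrite inE.
rewrite mulnC -sum_nat_const; apply: leq_sum => e eE; rewrite sum1_card.
(* All ordered pairs spanning e lie in the product of e with itself. *)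
have <- : #|finset.setX e e| = 4 by rewrite cardsX (eqP (forall_inP simpleE _ eE)).
apply/subset_leq_card/fintype.subsetP => -[x y]; rewrite !inE/= => /andP[_ /eqP<-].
by rewrite !inE !eqxx orbT.
Qed.

End Paths.

(** * Embeddings onto components and the rerouting move *)

Section ComponentEmbeddings.
Variables (U V : finType) (H : {set {set U}}).
Local Open Scope set_scope.
Local Open Scope nat_scope.
Implicit Types (E : {set {set V}}) (f g : {ffun U -> V}).

(** The last clause, closedness of the image under adjacency, is a local substitute for being a
    component. Counting maps rather than vertex sets makes the labelling of the copy part of the
    data. *)
Definition component_embs E : {set {ffun U -> V}} := finset (fun f =>
  [&& injectiveb f,
      [forall u, forall v, graph_adj H u v == graph_adj E (f u) (f v)]
    & [forall u, forall w, graph_adj E (f u) w ==> (w \in codom f)]]).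

Lemma component_embsP E f :
  reflect [/\ injective f, forall u v, graph_adj H u v = graph_adj E (f u) (f v)
            & forall u w, graph_adj E (f u) w -> w \in codom f]
    (f \in component_embs E).
Proof.
rewrite inE; apply: (iffP and3P) => -[injf adj cl].
  split=> [|u v|u w]; first exact/injectiveP.
    by apply/eqP; exact: (forallP (forallP adj u) v).
  by apply/implyP; exact: (forallP (forallP cl u) w).
split; first exact/injectiveP.
  by apply/forallP => u; apply/forallP => v; apply/eqP.
by apply/forallP => u; apply/forallP => w; apply/implyP/cl.
Qed.

Lemma has_component_embs E : has_component_iso H E -> component_embs E != finset.set0.
Proof.
move=> /existsP[x /existsP[f /and3P[injf /eqP imf adj]]].
apply/set0Pn; exists f; rewrite inE injf adj/=.
apply/forallP => u; apply/forallP => w; apply/implyP => uw.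
suff : w \in f @: [set: U] by case/imsetP => v _ ->; exact: codom_f.
have : f u \in f @: [set: U] by apply: imset_f; rewrite inE.
rewrite imf !inE => xu; exact: connect_trans xu (connect1 uw).
Qed.

Definition edge_image f : {set {set V}} := (fun e : {set U} => f @: e) @: H.

Hypothesis simpleH : simple_graph H.

(** An edge that meets the image has its other end there by closedness, and then comes from [H]
    because [f] reflects adjacency. *)
Lemma edge_imageE E f : simple_graph E -> f \in component_embs E ->
  edge_image f = [set e in E | ~~ [disjoint e & codom f]].
Proof.
move=> simpleE /component_embsP[injf adj cl]; apply/setP => e; rewrite inE.
apply/imsetP/andP => [[h hH ->]|[eE]].
  have [u [v [_ huv]]] := simple_edge simpleH hH.
  have : graph_adj H u v by rewrite /graph_adj -huv.
  rewrite huv imsetU1 imset_set1 adj; split=> //.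
  by apply/negP => /pred0P/(_ (f u)); rewrite /= !inE eqxx codom_f.
move=> /pred0Pn[w0 /= /andP[fue /codomP[u uE]]]; subst w0.
have [a [b [_ eab]]] := simple_edge simpleE eE.
have [w euw] : exists w, e = [set f u; w].
  move: fue; rewrite eab !inE => /orP[]/eqP->; first by exists b.
  by exists a; rewrite finset.setUC.
have : graph_adj E (f u) w by rewrite /graph_adj -euw.
move=> uw; have /codomP[v wE] := cl _ _ uw; subst w.
by exists [set u; v]; [rewrite [_ \in _]adj|rewrite euw imsetU1 imset_set1].
Qed.

Lemma card_edge_image f : injective f -> #|edge_image f| = #|H|.
Proof. by move=> injf; rewrite card_imset//; apply: imset_inj. Qed.

(* The move of the switching argument: the edges of the copy of [H] and the   *)
(* edges in [B] are traded for a path through the vertices of the copy.       *)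
Definition reroute E f (B : {set {set V}}) x (s : seq V) :=
  (E :\: edge_image f :\: B) :|: walk_edges x s.

(** Read in the rerouted graph, these are the edges that the move left alone, since every path edge
    meets the copy. *)
Definition off_copy E f : {set {set V}} := [set e in E | [disjoint e & codom f]].

Lemma path_closed (e : rel V) (a : pred V) x s :
  (forall y z, e y z -> (y \in a) = (z \in a)) -> path e x s ->
  {in x :: s, forall z, (z \in a) = (x \in a)}.
Proof.
move=> cl; elim: s x => [|y s IH] x /=; first by move=> _ z; rewrite inE => /eqP->.
move=> /andP[xy ys] z; rewrite inE => /predU1P[->//|zs].
by rewrite (IH y ys z zs) (cl _ _ xy).
Qed.

Section Reroute.
Variables (E : {set {set V}}) (f : {ffun U -> V}) (B : {set {set V}}).
Variables (x : V) (s : seq V).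
Hypotheses (simpleE : simple_graph E) (fE : f \in component_embs E).
Hypothesis subB : B \subset E :\: edge_image f.
Hypothesis pathB : forall e : {set V}, e \in B -> {subset e <= x :: s}.
Hypothesis copy_path : {subset codom f <= x :: s}.
Hypothesis path_touch : forall e : {set V},
  e \in walk_edges x s -> ~~ [disjoint e & codom f].
Hypotheses (uniq_path : uniq (x :: s)) (long_path : #|U| < size (x :: s)).
Hypothesis nonempty : 0 < #|U|.

Let E' := reroute E f B x s.

Lemma off_copy_reroute : off_copy E' f = E :\: edge_image f :\: B.
Proof.
apply/setP => e; rewrite /E' /reroute /off_copy !inE (edge_imageE simpleE fE) !inE.
case: (boolP (e \in walk_edges x s)) => [/path_touch/negbTE->|_];
  first by case: (e \in E); case: (e \in B).
by case: (e \in E); case: (e \in B); case: [disjoint e & codom f].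
Qed.

(** The right-hand side involves only the result, [f] and [B], so the move is undone once [f] and
    [B] have been read off the path. *)
Lemma reroute_inv : E = off_copy E' f :|: B :|: edge_image f.
Proof.
rewrite off_copy_reroute; apply/setP => e; rewrite !inE.
have : (e \in B) ==> (e \notin edge_image f) && (e \in E).
  by apply/implyP => /(fintype.subsetP subB); rewrite inE.
have : (e \in edge_image f) ==> (e \in E).
  by apply/implyP; rewrite (edge_imageE simpleE fE) inE => /andP[].
by case: (e \in edge_image f); case: (e \in B); case: (e \in E).
Qed.

Lemma reroute_copy_isolated u : isolated (E :\: edge_image f) (f u).
Proof.
apply/isolatedP => e; rewrite (edge_imageE simpleE fE) !inE.
move=> /andP[+ eE]; rewrite eE negbK => /pred0P/(_ (f u)) /=.
by rewrite codom_f andbT => ->.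
Qed.

Lemma reroute_adj u w : graph_adj E' (f u) w = ([set f u; w] \in walk_edges x s).
Proof.
rewrite /graph_adj /E' /reroute finset.in_setU; apply/orb_idl.
rewrite finset.in_setD => /andP[_].
by move=> /(isolatedP _ _ (reroute_copy_isolated u)); rewrite set21.
Qed.

(** An embedding into the new graph cannot meet the path: its closed image would contain all of it,
    which is more than [#|U|] vertices. Off the path nothing has changed, so it was already an
    embedding into [E], whereas [f] itself is lost. *)
Lemma reroute_embs : #|component_embs E'| < #|component_embs E|.
Proof.
have miss g u : g \in component_embs E' -> g u \notin x :: s.
  move=> /component_embsP[injg _ clg]; apply/negP => gus.
  have cl y z : graph_adj E' y z -> (y \in codom g) = (z \in codom g).
    move=> yz; apply/idP/idP => /codomP[v vE]; subst; first exact: clg yz.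
    by rewrite graph_adjC in yz; exact: clg yz.
  have pE' : path (graph_adj E') x s by apply: path_walk_edges; exact: finset.subsetUr.
  have inC := path_closed cl pE'.
  have : size (x :: s) <= size (codom g).
    apply: uniq_leq_size uniq_path _ => z zs.
    by rewrite inC// -(inC _ gus) codom_f.
  by rewrite size_codom leqNgt long_path.
have agree y z : y \notin x :: s -> graph_adj E' y z = graph_adj E y z.
  move=> ys; rewrite /graph_adj /E' /reroute.
  have W : [set y; z] \in walk_edges x s = false.
    by apply/negP => /walk_edges_vertex/(_ (set21 y z)); rewrite (negbTE ys).
  have nB : [set y; z] \in B = false.
    by apply/negP => /pathB/(_ y (set21 y z)); rewrite (negbTE ys).
  rewrite finset.in_setU W orbF !finset.in_setD nB/=; apply/andb_idl => yzE.
  (* A deleted copy edge at y would put y into the copy and hence on the path. *)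
  rewrite (edge_imageE simpleE fE) inE yzE negbK/=.
  apply/negPn/negP => /pred0Pn[w /= /andP[+ wf]].
  rewrite !inE => /orP[]/eqP wE; subst w; first by rewrite copy_path in ys.
  have /codomP[u zE] := wf; subst z.
  have /component_embsP[_ _ cl] := fE.
  have : graph_adj E (f u) y by rewrite graph_adjC.
  by move=> /cl/copy_path; rewrite (negbTE ys).
have [u0 _] := card_gt0P nonempty.
apply/proper_card/properP; split.
  apply/fintype.subsetP => g gE'; have gs := miss g ^~ gE'.
  have /component_embsP[injg adj clg] := gE'.
  apply/component_embsP; split=> // [u v|u w]; rewrite -agree//.
  exact: clg.
exists f => //; apply/negP => /(miss _ u0); rewrite copy_path//.
exact: codom_f.
Qed.

End Reroute.

Lemma card_off_edges E f : simple_graph E -> f \in component_embs E ->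
  #|E :\: edge_image f| = #|E| - #|H|.
Proof.
move=> simpleE fE; rewrite cardsDS; last first.
  rewrite (edge_imageE simpleE fE); apply/fintype.subsetP => e.
  by rewrite inE => /andP[].
by rewrite card_edge_image//; have /component_embsP[] := fE.
Qed.

(** The order of [enum U] makes the sequence of path vertices encode [f], to be read back by
    [of_list]. *)
Definition list_image f : seq V := [seq f u | u <- enum U].

(** Entries after the first [#|U|] are ignored, so the list may run on past the copy. *)
Definition of_list y (s : seq V) : {ffun U -> V} :=
  [ffun u => nth y s (index u (enum U))].

Lemma of_list_image f y s : of_list y (list_image f ++ s) = f.
Proof.
apply/ffunP => u; rewrite ffunE nth_cat size_map index_mem mem_enum.
by rewrite (nth_map u) ?nth_index// ?index_mem mem_enum.
Qed.

End ComponentEmbeddings.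

(** * The two switchings *)

Section Switching.
Variables (R : realType) (U V : finType) (H : {set {set U}}).
Local Open Scope set_scope.
Local Open Scope nat_scope.
Hypotheses (simpleH : simple_graph H) (U_gt0 : 0 < #|U|) (cardH : #|H| = #|U|).
Implicit Types (E : {set {set V}}) (f : {ffun U -> V}).

Definition planar_edge_sets m : {set {set {set V}}} :=
  finset (fun E : {set {set V}} => [&& simple_graph E, #|E| == m & `[< planar R E >]]).

Lemma planar_edge_setsP m E :
  reflect [/\ simple_graph E, #|E| = m & planar R E] (E \in planar_edge_sets m).
Proof.
rewrite inE; apply: (iffP and3P) => [[-> /eqP-> /asboolP]//|[-> -> pE]].
by split=> //; apply/asboolP.
Qed.

Lemma walk_edges_touch (a : pred V) x s (e : {set V}) :
  {in belast x s, forall z, a z} -> e \in walk_edges x s ->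
  exists2 z, z \in e & a z.
Proof.
elim: s x => [|y s IH] x /= ain; first by rewrite inE.
move=> /finset.setU1P[->|]; first by exists x; [exact: set21|apply: ain; exact: mem_head].
by apply: IH => z zs; apply: ain; rewrite inE zs orbT.
Qed.

Lemma list_imageP f : injective f ->
  [/\ uniq (list_image f), list_image f =i codom f, size (list_image f) = #|U|
    & exists t ts, list_image f = t :: ts].
Proof.
move=> injf; have sz : size (list_image f) = #|U| by rewrite size_map -cardE.
split=> //; first by rewrite map_inj_uniq ?enum_uniq.
by case: (list_image f) sz U_gt0 => [<-//|t ts _ _]; exists t, ts.
Qed.

(** The first path edge ends at t, and every later one starts in [belast t s]; both places belong to
    the copy. *)
Lemma touch_codom f t ts s (e : {set V}) :
  injective f -> list_image f = t :: ts -> {subset belast t s <= t :: ts} ->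
  forall x, e \in walk_edges x (t :: s) -> ~~ [disjoint e & codom f].
Proof.
move=> injf tE sub x; have [_ lf _ _] := list_imageP injf.
have touch z : z \in e -> z \in t :: ts -> ~~ [disjoint e & codom f].
  by move=> ze zt; apply/pred0Pn; exists z; rewrite /= ze -lf tE.
move=> /finset.setU1P[ee|]; first by apply: (touch t); rewrite ?ee ?set22 ?mem_head.
move=> /(walk_edges_touch (a := mem (t :: ts)))[]; first by move=> z /sub.
exact: touch.
Qed.

(** Here D = m - k, the number of edges off the copy, and C = 8k: since m >= 2k, the at most 4m
    codes number at most 8 (m - k) <= C D. *)
Lemma card_emb_free_dense m : 2 * #|U| <= m ->
  #|planar_edge_sets m| <= 2 * (8 * #|U|).+1 ^ (2 * (8 * #|U|)) *
    #|[set E in planar_edge_sets m | #|component_embs H E| == 0]|.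
Proof.
move=> m_large.
pose A E f := [set d : V * V | [&& [set d.1; d.2] \in E, d.1 \notin codom f
                                & d.2 \notin codom f]].
pose act E f (d : V * V) :=
  reroute H E f [set [set d.1; d.2]] d.1 (rcons (list_image f) d.2).
pose codes E := [set d : V * V | graph_adj E d.1 d.2].
(* From (x, t_1), k further steps yield t_2, ..., t_k and then y: the first k entries of [s] give
   [f], the last one the edge xy to restore. *)
pose dec E (d : V * V) :=
  let s := d.2 :: follow E d.1 d.2 #|U| in
  let f := of_list U d.2 s in
  let y := last d.2 s in
  (off_copy E f :|: [set [set d.1; y]] :|: edge_image H f, f, (d.1, y)).
apply: (@card_emb_free _ _ _ _ _ (component_embs H) A act codes dec _ (m - #|U|)).
- by move: U_gt0; lia.
- move=> E f /planar_edge_setsP[simpleE cardE _] fE.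
  rewrite -cardE -cardH -(card_off_edges simpleH simpleE fE).
  apply: (@leq_trans #|[set [set d.1; d.2] | d in A E f]|); last exact: leq_imset_card.
  apply/subset_leq_card/fintype.subsetP => e.
  rewrite (edge_imageE simpleH simpleE fE) !inE => /andP[+ eE].
  rewrite eE negbK /= => /pred0P dis.
  have [a [b [_ eab]]] := simple_edge simpleE eE.
  apply/imsetP; exists (a, b) => //; rewrite inE/= -eab eE /=.
  have := dis a; have := dis b; rewrite /= {1 2}eab set21 set22/= => -> ->.
  by [].
- move=> E f [x y] /planar_edge_setsP[simpleE cardE planarE] fE.
  rewrite inE => /= /and3P[xyE xf yf].
  have [injf _ _] := component_embsP _ _ _ fE.
  have [ul lf sl [t [ts tE]]] := list_imageP injf.
  set E0 := E :\: edge_image H f.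
  have iso u : isolated E0 (f u) by exact: reroute_copy_isolated.
  have isol : {in list_image f, forall z, isolated E0 z}.
    by move=> z; rewrite lf => /codomP[u ->].
  have xy : x != y by exact: simple_adj xyE.
  have up : uniq (x :: rcons (list_image f) y).
    by rewrite /= rcons_uniq mem_rcons inE negb_or xy !lf xf yf.
  have xyE0 : [set x; y] \in E0.
    rewrite inE xyE andbT (edge_imageE simpleH simpleE fE) inE xyE negbK/=.
    apply/pred0P => z /=; rewrite !inE.
    by case: eqVneq => [->|_]; [exact: negbTE|case: eqVneq => [->|_//]; exact: negbTE].
  have sub0 : E0 \subset E by exact: finset.subsetDl.
  have [simpleE' cardE' planarE'] := subdivide_path (subset_simple sub0 simpleE)
    (planar_subset sub0 planarE) xyE0 up isol.
  have subB : [set [set x; y]] \subset E0 by rewrite finset.sub1set.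
  have pathB (e : {set V}) : e \in [set [set x; y]] ->
      {subset e <= x :: rcons (list_image f) y}.
    move=> /finset.set1P-> z; rewrite !inE mem_rcons inE.
    by case/orP => ->; rewrite ?orbT.
  have copy_path : {subset codom f <= x :: rcons (list_image f) y}.
    by move=> z; rewrite -lf inE mem_rcons inE => ->; rewrite !orbT.
  have path_touch (e : {set V}) : e \in walk_edges x (rcons (list_image f) y) ->
      ~~ [disjoint e & codom f].
    rewrite tE rcons_cons; apply: touch_codom tE _ _ => //.
    by rewrite belast_rcons.
  have long : #|U| < size (x :: rcons (list_image f) y).
    by rewrite /= size_rcons sl.
  split.
  + apply/planar_edge_setsP; split=> //.
    (* Of the m edges, m - |H| remain, and subdividing gains k; the equality |H| = k restores m. *)
    rewrite [LHS]cardE' (card_off_edges simpleH simpleE fE) cardH sl cardE.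
    by move: m_large; lia.
  + exact: reroute_embs.
  exists (x, t).
    by rewrite inE/= /graph_adj /act /reroute tE/= !inE eqxx orbT.
  rewrite /dec /=.
  have -> : follow (act E f (x, y)) x t #|U| = rcons ts y.
    have <- : size (rcons ts y) = #|U| by rewrite size_rcons -sl tE.
    apply: follow_path; first by rewrite -rcons_cons -tE.
    move=> z w; rewrite belast_rcons -tE lf => /codomP[u ->].
    by rewrite -rcons_cons -tE; apply: reroute_adj.
  have -> : of_list U t (t :: rcons ts y) = f.
    by rewrite -cats1 -cat_cons -tE of_list_image.
  by rewrite last_rcons; congr (_, _, _); apply/esym/reroute_inv.
- move=> E /planar_edge_setsP[simpleE cardE _].
  by apply: leq_trans (card_darts simpleE) _; move: U_gt0 m_large; nia.
Qed.

(** The edges cover at most [2 * #|E|] vertices, and the copy takes up [#|U|] more. *)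
Lemma exists_isolated E f : simple_graph E -> 2 * #|E| + #|U| < #|V| ->
  0 < #|[set x | isolated E x & x \notin codom f]|.
Proof.
move=> simpleE few; rewrite card_gt0; apply/negP => /eqP none.
have : [set: V] \subset finset.cover E :|: [set x in codom f].
  apply/fintype.subsetP => x _; rewrite !inE.
  apply/negPn; rewrite negb_or; apply/negP => /andP[xE xf].
  have : x \in [set x | isolated E x & x \notin codom f].
    rewrite inE xf andbT; apply/isolatedP => e eE; apply: contraNN xE => xe.
    by apply/bigcupP; exists e.
  by rewrite none inE.
move=> /subset_leq_card; rewrite cardsT leqNgt => /negP; apply.
apply: leq_ltn_trans few; apply: leq_trans (leq_card_setU _ _).1 _.
apply: leq_add.
  apply: leq_trans (leq_card_cover _).1 _.
  rewrite mulnC -sum_nat_const; apply: leq_sum => e eE.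
  by rewrite (eqP (forall_inP simpleE _ eE)).
by rewrite cardsE (leq_trans (card_size _)) ?size_codom.
Qed.

(** Few edges mean few codes, at most 4m < 8k, so D = 1 suffices: an isolated vertex off the copy
    exists because 2m + k < 5k < [#|V|]. *)
Lemma card_emb_free_sparse m : m < 2 * #|U| -> 5 * #|U| < #|V| ->
  #|planar_edge_sets m| <= 2 * (8 * #|U|).+1 ^ (2 * (8 * #|U|)) *
    #|[set E in planar_edge_sets m | #|component_embs H E| == 0]|.
Proof.
move=> m_small V_large.
pose A E f := [set x | isolated E x & x \notin codom f].
pose act E f x := reroute H E f finset.set0 x (list_image f).
pose codes E := [set d : V * V | graph_adj E d.1 d.2].
(* The path now ends inside the copy, so k - 1 steps from t_1 reach t_k. *)
pose dec E (d : V * V) :=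
  let f := of_list U d.2 (d.2 :: follow E d.1 d.2 #|U|.-1) in
  (off_copy E f :|: finset.set0 :|: edge_image H f, f, d.1).
apply: (@card_emb_free _ _ _ _ _ (component_embs H) A act codes dec _ 1) => //.
- move=> E f /planar_edge_setsP[simpleE cardE _] fE.
  by apply: exists_isolated => //; rewrite cardE; lia.
- move=> E f x /planar_edge_setsP[simpleE cardE planarE] fE.
  rewrite inE => /andP[isox xf].
  have [injf _ _] := component_embsP _ _ _ fE.
  have [ul lf sl [t [ts tE]]] := list_imageP injf.
  set E0 := E :\: edge_image H f.
  have isol : {in list_image f, forall z, isolated E0 z}.
    by move=> z; rewrite lf => /codomP[u ->]; exact: reroute_copy_isolated.
  have up : uniq (x :: list_image f) by rewrite /= lf xf.
  have sub0 : E0 \subset E by exact: finset.subsetDl.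
  have size0 : 0 < size (list_image f) by rewrite sl.
  have := attach_path (subset_simple sub0 simpleE) (planar_subset sub0 planarE)
    (subset_isolated sub0 isox) up isol size0.
  have -> : E0 :|: walk_edges x (list_image f) = act E f x.
    by rewrite /act /reroute finset.setD0.
  move=> [simpleE' cardE' planarE'].
  have subB : finset.set0 \subset E0 by exact: finset.sub0set.
  have pathB (e : {set V}) : e \in finset.set0 -> {subset e <= x :: list_image f}.
    by rewrite inE.
  have copy_path : {subset codom f <= x :: list_image f}.
    by move=> z; rewrite -lf inE => ->; rewrite orbT.
  have path_touch (e : {set V}) : e \in walk_edges x (list_image f) ->
      ~~ [disjoint e & codom f].
    by rewrite tE; apply: touch_codom tE _ _ => // z; exact: mem_belast.
  have long : #|U| < size (x :: list_image f) by rewrite /= sl.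
  split.
  + apply/planar_edge_setsP; split=> //.
    rewrite cardE' (card_off_edges simpleH simpleE fE) cardH sl cardE.
    (* The truncated subtraction m - k is exact because the k edges of the copy belong to [E]. *)
    rewrite subnK// -cardE -cardH -(card_edge_image H injf).
    rewrite (edge_imageE simpleH simpleE fE).
    by apply/subset_leq_card/fintype.subsetP => e; rewrite inE => /andP[].
  + exact: reroute_embs.
  exists (x, t).
    by rewrite inE/= /graph_adj /act /reroute tE/= !inE eqxx orbT.
  rewrite /dec /=.
  have -> : follow (act E f x) x t #|U|.-1 = ts.
    have <- : size ts = #|U|.-1 by rewrite -sl tE.
    apply: follow_path; first by rewrite -tE.
    move=> z w /mem_belast; rewrite -tE lf => /codomP[u ->].
    exact: reroute_adj.
  have -> : of_list U t (t :: ts) = f.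
    by rewrite -tE -[list_image f]cats0 of_list_image.
  by congr (_, _, _); apply/esym/reroute_inv.
- move=> E /planar_edge_setsP[simpleE cardE _].
  by apply: leq_trans (card_darts simpleE) _; lia.
Qed.

Lemma card_iso_free m : 5 * #|U| < #|V| ->
  #|planar_edge_sets m| <= 2 * (8 * #|U|).+1 ^ (2 * (8 * #|U|)) *
    #|[set E in planar_edge_sets m | ~~ has_component_iso H E]|.
Proof.
move=> V_large; set K := 2 * _.
apply: (@leq_trans (K * #|[set E in planar_edge_sets m | #|component_embs H E| == 0]|)).
  have [?|?] := leqP (2 * #|U|) m; first exact: card_emb_free_dense.
  exact: card_emb_free_sparse.
rewrite leq_mul2l; apply/orP; right; apply/subset_leq_card/fintype.subsetP => E.
rewrite !inE => /andP[-> emb0]/=; apply: contraL emb0 => /has_component_embs.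
by rewrite cards_eq0.
Qed.

End Switching.

(** * Passage to the limit superior *)

Unset Implicit Arguments.

Theorem theorem4p2 (R : realType) (U : finType) (H : {set {set U}})
    (simpleH : simple_graph H) (unicyclicH : unicyclic H)
    (planarH : planar R H) (m : nat -> nat)
    (nonemptyP : forall n : nat, (0 < n)%N -> (0 < #|planar_graphs R n (m n)|)%N) :
  (limn_esup (fun n : nat =>
     (uniform_choice_prob R (planar_graphs R n (m n)) (has_component_iso H))%:E) < 1%:E)%E.
Proof.
have /andP[/andP[U_gt0 _] /eqP cardH] := unicyclicH.
(* The constant of [card_iso_free], the same for all n and m. *)
pose K := (2 * (8 * #|U|).+1 ^ (2 * (8 * #|U|)))%N.
have K_gt0 : (0 < K%:R :> R) by rewrite ltr0n muln_gt0 expn_gt0.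
apply: (@le_lt_trans _ _ ((1 - K%:R^-1 : R)%:E)); last first.
  by rewrite lte_fin ltrBlDr ltrDl invr_gt0.
(* The limit superior is an infimum of suprema over tails, so a bound on the single tail n > 5k is
   enough. *)
rewrite /limn_esup limf_esupE; set tail := [set n : nat | (5 * #|U| < n)%N]%classic.
apply: (@le_trans _ _ (ereal_sup ((fun n => (uniform_choice_prob R
  (planar_graphs R n (m n)) (has_component_iso H))%:E) @` tail)%classic)).
  by apply: ereal_inf_lbound; exists tail => //; exists (5 * #|U|).+1.
apply: ge_ereal_sup => _ [n /= n_large <-]; rewrite lee_fin /uniform_choice_prob.
set S := planar_graphs R n (m n).
have S_gt0 : (0 < #|S|%:R :> R) by rewrite ltr0n nonemptyP// (leq_ltn_trans _ n_large).
have free : (#|S| <= K * #|[set E in S | ~~ has_component_iso H E]%SET|)%N.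
  by apply: card_iso_free; rewrite ?card_ord.
have split_S : (#|S| = #|[predI S & has_component_iso H]| +
    #|[set E in S | ~~ has_component_iso H E]%SET|)%N.
  rewrite -(cardID (has_component_iso H) S); congr (_ + _)%N.
  by apply: eq_card => E; rewrite !inE andbC.
rewrite ler_pdivrMr// mulrBl mul1r lerBrDr.
rewrite [leRHS](_ : _ = (#|[predI S & has_component_iso H]|%:R +
  #|[set E in S | ~~ has_component_iso H E]%SET|%:R)); last by rewrite -natrD -split_S.
by rewrite lerD2l mulrC ler_pdivrMr// mulrC -natrM ler_nat.
Qed.
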